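(* Let $m\ge 2$ be an integer and let $n=2m-3$. Then there exists a set of $n$ distinct angles in $(0,\pi)$ such that, for every dimension $d$, no arrangement of $m$ points in $\mathbb{R}^d$ realises all angles in the set.
   Context: All angles are assumed to lie strictly between $0$ and $\pi$. A set of points in $\mathbb{R}^d$ realises an angle $\theta$ if there are points $A,B,C$ in the set such that $\angle ABC=\theta$ (the angle at $B$ between the rays $BA$ and $BC$). An arrangement of $m$ points is a set of $m$ distinct points. *)

(* Defs.v *)
From HB Require Import structures.
From mathcomp Require Import all_boot all_order all_algebra.
From mathcomp Require Import all_classical all_reals all_analysis.

Set Implicit Arguments.
Unset Strict Implicit.
Unset Printing Implicit Defensive.

Import Order.TTheory GRing.Theory Num.Theory.

Local Open Scope classical_set_scope.
Local Open Scope ring_scope.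

Definition dotv (R : realType) (d : nat) (u v : 'rV[R]_d) : R :=
  \sum_(i < d) u 0 i * v 0 i.

(* The library norm `|u| on 'rV[R]_d is the sup norm, not the Euclidean one. *)
Definition enorm (R : realType) (d : nat) (u : 'rV[R]_d) : R :=
  Num.sqrt (dotv u u).

(* The angle at B between the rays BA and BC, in [0, pi]; it is meaningful only
   when A != B and C != B (otherwise it evaluates to acos 0). *)
Definition angle (R : realType) (d : nat) (A B C : 'rV[R]_d) : R :=
  acos (dotv (A - B) (C - B) / (enorm (A - B) * enorm (C - B))).

(* A = C is not excluded: it gives the angle 0, which is not in ]0, pi[. *)
Definition realises (R : realType) (d : nat) (X : set 'rV[R]_d) (theta : R) :
    Prop :=
  exists A B C : 'rV[R]_d,
    [/\ X A, X B & X C] /\ [/\ A != B, C != B & angle A B C = theta].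

(* Main.v *)
Require Import Defs.
From HB Require Import structures.
From mathcomp Require Import all_boot all_order all_algebra.
From mathcomp Require Import all_classical all_reals all_analysis.
From mathcomp Require Import ring lra zify.

(* A suitable projection to a plane changes the sine of each angle determined by
   m points of R^d only by a factor bounded in terms of m, and replaces it by a
   difference of two slopes.  After normalising, these differences are rational
   functions of 2m - 4 real parameters, so any 2m - 3 of them satisfy a
   nontrivial polynomial relation, of degree bounded in terms of m.  Such a
   relation is impossible for quantities comparable to delta^(M^i) when delta is
   small and M exceeds the degree, since all the monomials then have different
   orders of magnitude.  There are finitely many ways to choose the triples of
   points, so one delta defeats them all. *)

Set Implicit Arguments.
Unset Strict Implicit.
Unset Printing Implicit Defensive.

Import Order.TTheory GRing.Theory Num.Theory.

Local Open Scope classical_set_scope.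
Local Open Scope ring_scope.

(** * Polynomial functions of bounded degree in each variable *)

Section BoundedDegree.
Variables (R : comNzRingType) (V : finType).

(** The degree is bounded in each variable separately, so [E.+1 ^ #|V|] coefficients suffice; this
    count drives the algebraic relation below. *)
Definition poly_fun (E : nat) (g : (V -> R) -> R) : Prop :=
  exists c : {ffun V -> 'I_E.+1} -> R,
    forall z, g z = \sum_b c b * \prod_i z i ^+ b i.

Lemma eq_poly_fun E (g h : (V -> R) -> R) :
  g =1 h -> poly_fun E g -> poly_fun E h.
Proof. by move=> gh [c Hc]; exists c => z; rewrite -gh. Qed.

Lemma poly_fun_monomial E (e : V -> nat) : (forall i, (e i <= E)%N) ->
  poly_fun E (fun z => \prod_i z i ^+ e i).
Proof.
move=> He; exists (fun b => (b == [ffun i => inord (e i)])%:R) => z.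
rewrite (bigD1 [ffun i => inord (e i)]) //= eqxx mul1r [X in _ + X]big1 ?addr0.
  by apply: eq_bigr => i _; rewrite ffunE inordK // ltnS.
by move=> b /negbTE ->; rewrite mul0r.
Qed.

Lemma poly_fun_sum E (I : finType) (g : I -> (V -> R) -> R) (a : I -> R) :
  (forall i, poly_fun E (g i)) -> poly_fun E (fun z => \sum_i a i * g i z).
Proof.
move=> /(@fin_all_exists _ _ _) [c Hc].
exists (fun b => \sum_i a i * c i b) => z.
under eq_bigr do rewrite Hc mulr_sumr.
rewrite exchange_big; apply: eq_bigr => b _; rewrite mulr_suml.
by apply: eq_bigr => i _; rewrite mulrA.
Qed.

Lemma poly_fun_const E (a : R) : poly_fun E (fun=> a).
Proof.
have := poly_fun_sum (fun _ : 'I_1 => a)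
  (fun=> @poly_fun_monomial E (fun=> 0%N) (fun=> leq0n _)).
by apply: eq_poly_fun => z; rewrite big_ord1 big1 ?mulr1.
Qed.

Lemma poly_fun_var (i : V) : poly_fun 1 (fun z => z i).
Proof.
apply: eq_poly_fun (@poly_fun_monomial 1 (fun j => (j == i) : nat) _).
  move=> z; rewrite (bigD1 i) //= eqxx expr1 big1 ?mulr1 // => j /negbTE ->.
  exact: expr0.
by move=> j; case: (j == i).
Qed.

Lemma poly_funB E (g h : (V -> R) -> R) :
  poly_fun E g -> poly_fun E h -> poly_fun E (fun z => g z - h z).
Proof.
move=> [c Hc] [c' Hc']; exists (fun b => c b - c' b) => z.
by rewrite Hc Hc' -sumrB; apply: eq_bigr => b _; rewrite mulrBl.
Qed.

Lemma poly_funM E E' (g h : (V -> R) -> R) :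
  poly_fun E g -> poly_fun E' h -> poly_fun (E + E') (fun z => g z * h z).
Proof.
move=> [c Hc] [c' Hc'].
have H (u : {ffun V -> 'I_E.+1} * {ffun V -> 'I_E'.+1}) :
  poly_fun (E + E') (fun z => \prod_i z i ^+ (u.1 i + u.2 i)).
  by apply: poly_fun_monomial => i; rewrite leq_add // -ltnS.
apply: eq_poly_fun (poly_fun_sum (fun u => c u.1 * c' u.2) H) => z.
rewrite Hc Hc' big_distrlr pair_big /=; apply: eq_bigr => u _.
under eq_bigr do rewrite exprD.
by rewrite big_split /= mulrACA.
Qed.

Lemma poly_funX E (g : (V -> R) -> R) k :
  poly_fun E g -> poly_fun (E * k) (fun z => g z ^+ k).
Proof.
move=> Hg; elim: k => [|k IH]; first by rewrite muln0; exact: poly_fun_const.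
by rewrite mulnS; apply: eq_poly_fun (poly_funM Hg IH) => z; rewrite exprS.
Qed.

Lemma poly_fun_prod E n (g : 'I_n -> (V -> R) -> R) :
  (forall i, poly_fun E (g i)) -> poly_fun (n * E) (fun z => \prod_i g i z).
Proof.
elim: n g => [|n IH] g Hg.
  by apply: eq_poly_fun (poly_fun_const _ 1) => z; rewrite big_ord0.
rewrite mulSn.
apply: eq_poly_fun (poly_funM (Hg ord0) (IH _ (fun i => Hg (lift ord0 i)))) => z.
by rewrite big_ord_recl.
Qed.

End BoundedDegree.

(** * Algebraic dependence by counting dimensions *)

Lemma exists_linear_relation (F : fieldType) (A B : finType) (c : A -> B -> F) :
  (#|B| < #|A|)%N ->
  exists2 v : A -> F, exists a, v a != 0 & forall b, \sum_a v a * c a b = 0.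
Proof.
move=> ltBA; pose M := \matrix_(i < #|A|, j < #|B|) c (enum_val i) (enum_val j).
have: kermx M != 0.
  rewrite -mxrank_eq0 mxrank_ker subn_eq0 -ltnNge.
  exact: leq_ltn_trans (rank_leq_col M) ltBA.
move=> /rowV0Pn [w /sub_kermxP wM /rV0Pn [j wj]].
exists (fun a => w 0 (enum_rank a)); first by exists (enum_val j); rewrite enum_valK.
move=> b; have := congr1 (fun X : 'rV_#|B| => X 0 (enum_rank b)) wM.
rewrite !mxE => sum0; rewrite -[RHS]sum0 (reindex (@enum_val A predT)) /=; last first.
  by apply: onW_bij; exact: enum_val_bij.
by apply: eq_bigr => i _; rewrite mxE !enum_valK enum_rankK.
Qed.

(* The monomials in [p i / q i] of degree at most [D] in each factor, times the
   common denominator, number [D.+1 ^ n] and lie in a space of dimension at most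
   [(e * n * D.+1) ^ #|V|], which is smaller when [#|V| < n] and [D] is large. *)
Lemma exists_algebraic_relation (F : fieldType) (V : finType) (n e D : nat)
    (p q : 'I_n -> (V -> F) -> F) :
  (0 < e * n)%N -> (#|V| < n)%N -> ((e * n) ^ #|V| <= D)%N ->
  (forall i, poly_fun e (p i)) -> (forall i, poly_fun e (q i)) ->
  exists2 v : {ffun 'I_n -> 'I_D.+1} -> F, exists a, v a != 0 &
    forall z, \sum_a v a * \prod_i (p i z ^+ a i * q i z ^+ (D - a i)) = 0.
Proof.
move=> en0 ltVn leD Hp Hq.
have H (a : {ffun 'I_n -> 'I_D.+1}) :
  poly_fun (n * (e * D)) (fun z => \prod_i (p i z ^+ a i * q i z ^+ (D - a i))).
  apply: poly_fun_prod => i.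
  have -> : (e * D = e * a i + e * (D - a i))%N by rewrite -mulnDr subnKC // -ltnS.
  by apply: poly_funM; apply: poly_funX.
have [c Hc] := fin_all_exists H.
have [|v v0 Hv] := @exists_linear_relation F _ _ c.
  rewrite !card_ffun !card_ord.
  (* As [0 < e * n], there are at most [e * n * D.+1] exponents per variable. The factor
     [(e * n) ^ #|V| <= D] costs less than one power of [D.+1], which [#|V| < n] leaves
     available. *)
  apply: (@leq_ltn_trans ((e * n * D.+1) ^ #|V|)).
    by case: (#|V|) => [|r]; rewrite // leq_exp2r //; nia.
  rewrite expnMn; apply: (@leq_trans (D.+1 * D.+1 ^ #|V|)).
    by rewrite ltn_pmul2r ?expn_gt0.
  by rewrite -expnS leq_pexp2l.
exists v => // z.
under eq_bigr do rewrite Hc mulr_sumr.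
rewrite exchange_big big1 // => b _.
under eq_bigr do rewrite mulrA.
by rewrite -mulr_suml Hv mul0r.
Qed.

(** * Monomials in lacunary powers of a small number *)

Lemma expansion_inj n D (a b : 'I_n -> 'I_D.+1) :
  (\sum_i a i * D.+1 ^ i = \sum_i b i * D.+1 ^ i)%N -> a =1 b.
Proof.
elim: n a b => [|n IH] a b; first by move=> _ [].
have E (f : 'I_n.+1 -> 'I_D.+1) : (\sum_i f i * D.+1 ^ i =
    (\sum_(i < n) f (lift ord0 i) * D.+1 ^ i) * D.+1 + f ord0)%N.
  rewrite big_ord_recl expn0 muln1 addnC big_distrl /=; congr addn.
  by apply: eq_bigr => i _; rewrite /bump leq0n add1n expnSr mulnA.
rewrite !E => H.
have /IH Hl : (\sum_(i < n) a (lift ord0 i) * D.+1 ^ i =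
               \sum_(i < n) b (lift ord0 i) * D.+1 ^ i)%N.
  (* Division by [D.+1] separates the lowest digit from the others. *)
  by have /(congr1 (divn^~ D.+1)) := H; rewrite !divnMDl // !divn_small ?addn0.
have H0 : a ord0 = b ord0.
  by apply: val_inj; have /(congr1 (modn^~ D.+1)) := H; rewrite !modnMDl !modn_small.
by move=> i; case: (unliftP ord0 i) => [j|] ->; rewrite ?H0 ?Hl.
Qed.

(* Distinct exponents [a] give monomials of distinct integral orders
   [\sum_i a i * D.+1 ^ i] in [delta], so the one of least order dominates. *)
Lemma lacunary_no_relation (R : realFieldType) n D
    (v : {ffun 'I_n -> 'I_D.+1} -> R) (c C : R) :
  (exists a, v a != 0) -> 0 < c -> 0 <= C ->
  exists2 delta0, 0 < delta0 & forall delta, 0 < delta <= 1 -> delta < delta0 ->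
    forall f : 'I_n -> R,
    (forall i : 'I_n, c * delta ^+ (D.+1 ^ i) <= `|f i| <= C * delta ^+ (D.+1 ^ i)) ->
    \sum_a v a * \prod_i f i ^+ a i != 0.
Proof.
move=> [a1 va1] c0 C0.
pose N (a : {ffun 'I_n -> 'I_D.+1}) := (\sum_i a i * D.+1 ^ i)%N.
pose s (a : {ffun 'I_n -> 'I_D.+1}) := (\sum_i a i)%N.
have [a va amin] := @arg_minnP _ a1 (fun a => v a != 0) N va1.
pose T := \sum_b `|v b| * C ^+ s b.
have T0 : 0 <= T by apply: sumr_ge0 => b _; rewrite mulr_ge0 ?exprn_ge0.
(* Below this threshold [T * delta < |v a| * c ^+ s a], so the term of [a] outweighs all others
   together; [1 + T] guards against [T = 0]. *)
exists (`|v a| * c ^+ s a / (1 + T)).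
  by rewrite divr_gt0 ?mulr_gt0 ?normr_gt0 ?exprn_gt0 ?ltr_wpDr.
move=> delta /andP[d0 d1]; rewrite ltr_pdivlMr ?ltr_wpDr // => dlt f Hf.
have E (k : R) (b : {ffun 'I_n -> 'I_D.+1}) :
    \prod_(i < n) (k * delta ^+ (D.+1 ^ i)) ^+ b i = k ^+ s b * delta ^+ N b.
  under eq_bigr do rewrite exprMn -exprM mulnC.
  by rewrite big_split /= !prodrXr.
apply/negP => /eqP; rewrite (bigD1 a) //= => /eqP; rewrite addr_eq0 => /eqP H.
have lower : c ^+ s a * delta ^+ N a <= `|\prod_i f i ^+ a i|.
  rewrite -E normr_prod; apply: ler_prod => i _; rewrite normrX.
  have /andP[Hc _] := Hf i.
  by rewrite exprn_ge0 ?lerXn2r ?nnegrE ?mulr_ge0 ?exprn_ge0 ?(ltW c0) ?(ltW d0).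
have upper b : b != a ->
    `|v b * \prod_i f i ^+ b i| <= `|v b| * C ^+ s b * (delta ^+ N a * delta).
  move=> ba; have [->|vb] := eqVneq (v b) 0; first by rewrite !(normr0, mul0r).
  rewrite normrM -mulrA ler_wpM2l //.
  apply: (@le_trans _ _ (C ^+ s b * delta ^+ N b)).
    rewrite -E normr_prod; apply: ler_prod => i _; rewrite normrX.
    have /andP[_ HC] := Hf i.
    by rewrite exprn_ge0 ?lerXn2r ?nnegrE ?mulr_ge0 ?exprn_ge0 ?(ltW d0).
  (* By uniqueness of digits the minimum [N a] is attained only at [a] among nonzero coefficients,
     so [N b] is at least [N a + 1]: hence the extra factor [delta]. *)
  rewrite ler_wpM2l ?exprn_ge0 // -exprSr ler_wiXn2l ?(ltW d0) // ltn_neqAle amin //.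
  rewrite andbT; apply: contra ba => /eqP Nab; apply/eqP/ffunP => j.
  by rewrite (expansion_inj Nab).
have : `|v a| * c ^+ s a * delta ^+ N a <= T * delta * delta ^+ N a.
  apply: (@le_trans _ _ `|v a * \prod_i f i ^+ a i|).
    by rewrite normrM -mulrA ler_wpM2l.
  rewrite H normrN; apply: le_trans (ler_norm_sum _ _ _) _.
  apply: le_trans (ler_sum _ upper) _.
  rewrite -mulr_suml [delta ^+ _ * _]mulrC mulrA ler_wpM2r ?exprn_ge0 ?(ltW d0) //.
  rewrite ler_wpM2r ?(ltW d0) // /T [leRHS](bigD1 a) //=.
  by rewrite lerDr mulr_ge0 ?exprn_ge0.
rewrite ler_pM2r ?exprn_gt0 //; nra.
Qed.

(** * Euclidean geometry in arbitrary dimension *)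

Section Euclidean.
Variables (R : realType) (d : nat).
Implicit Types u v w e : 'rV[R]_d.

Lemma dotvC u v : dotv u v = dotv v u.
Proof. by apply: eq_bigr => i _; rewrite mulrC. Qed.

Lemma dotvDl u v w : dotv (u + v) w = dotv u w + dotv v w.
Proof. by rewrite -big_split; apply: eq_bigr => i _; rewrite mxE mulrDl. Qed.

Lemma dotvZl (a : R) u w : dotv (a *: u) w = a * dotv u w.
Proof. by rewrite /dotv mulr_sumr; apply: eq_bigr => i _; rewrite mxE mulrA. Qed.

Lemma dotvBl u v w : dotv (u - v) w = dotv u w - dotv v w.
Proof. by rewrite -scaleN1r dotvDl dotvZl mulN1r. Qed.

Lemma dotvDr w u v : dotv w (u + v) = dotv w u + dotv w v.
Proof. by rewrite dotvC dotvDl !(dotvC w). Qed.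

Lemma dotvZr (a : R) w u : dotv w (a *: u) = a * dotv w u.
Proof. by rewrite dotvC dotvZl dotvC. Qed.

Lemma dotvBr w u v : dotv w (u - v) = dotv w u - dotv w v.
Proof. by rewrite dotvC dotvBl !(dotvC w). Qed.

Definition dotvE := (dotvBl, dotvBr, dotvDl, dotvDr, dotvZl, dotvZr).

Lemma dotvv_ge0 u : 0 <= dotv u u.
Proof. by apply: sumr_ge0 => i _; rewrite -expr2 sqr_ge0. Qed.

Lemma dotvv_eq0 u : (dotv u u == 0) = (u == 0).
Proof.
apply/eqP/eqP => [/psumr_eq0P H|->]; last first.
  by rewrite /dotv big1 // => i _; rewrite mxE mul0r.
apply/rowP => i; apply/eqP; rewrite mxE -sqrf_eq0 expr2 H // => j _.
by rewrite -expr2 sqr_ge0.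
Qed.

Lemma dotvv_gt0 u : (0 < dotv u u) = (u != 0).
Proof. by rewrite lt0r dotvv_ge0 dotvv_eq0 andbT. Qed.

Lemma dotv_sqr_le u v : dotv u v ^+ 2 <= dotv u u * dotv v v.
Proof.
have [->|] := eqVneq v 0.
  by rewrite -(scale0r 0) !dotvE !mul0r expr0n mulr0.
rewrite -dotvv_gt0 => v0; rewrite -(ler_pM2l v0) -subr_ge0.
have := dotvv_ge0 (dotv v v *: u - dotv u v *: v).
rewrite !dotvE (dotvC v u); congr (_ <= _); ring.
Qed.

Lemma enorm_ge0 u : 0 <= enorm u.
Proof. exact: sqrtr_ge0. Qed.

Lemma sqr_enorm u : enorm u ^+ 2 = dotv u u.
Proof. by rewrite sqr_sqrtr ?dotvv_ge0. Qed.

Lemma enorm_gt0 u : (0 < enorm u) = (u != 0).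
Proof. by rewrite sqrtr_gt0 dotvv_gt0. Qed.

Lemma normr_dotv_le u v : `|dotv u v| <= enorm u * enorm v.
Proof.
rewrite -(@ler_pXn2r _ 2) ?nnegrE ?mulr_ge0 ?enorm_ge0 //.
by rewrite real_normK ?num_real // exprMn !sqr_enorm dotv_sqr_le.
Qed.

Lemma enormZ (a : R) u : enorm (a *: u) = `|a| * enorm u.
Proof. by rewrite /enorm !dotvE mulrA -expr2 sqrtrM ?sqr_ge0 // sqrtr_sqr. Qed.

Lemma enormD u v : enorm (u + v) <= enorm u + enorm v.
Proof.
rewrite -(@ler_pXn2r _ 2) ?nnegrE ?addr_ge0 ?enorm_ge0 //.
rewrite sqr_enorm !dotvE sqrrD !sqr_enorm (dotvC v u).
have := le_trans (ler_norm _) (normr_dotv_le u v); lra.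
Qed.

(* The vectors are added one at a time: moving [e] along a new vector [u] by at
   most half of the current margin keeps the old inequalities and creates the
   new one. *)
Lemma exists_separating (s : seq 'rV[R]_d) : exists2 e, dotv e e <= 1 &
  forall u, u \in s -> 4^-1 ^+ size s * enorm u <= `|dotv u e|.
Proof.
(* The induction keeps the norm of [e] away from 1, which leaves room for the next displacement. *)
suff [e He Hs] : exists2 e, enorm e <= 1 - 4^-1 ^+ size s &
    forall u, u \in s -> 4^-1 ^+ size s * enorm u <= `|dotv u e|.
  exists e => //; rewrite -sqr_enorm expr_le1 ?enorm_ge0 //.
  apply: le_trans He _; rewrite gerBl; apply: exprn_ge0; lra.
elim: s => [|u s [e He Hs]].
  by exists 0 => //; rewrite -(scale0r 0) enormZ normr0 mul0r expr0 subrr.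
have c0 : 0 < 4^-1 ^+ size s :> R by apply: exprn_gt0; lra.
rewrite /= exprS; move: (4^-1 ^+ size s) c0 He Hs => c c0 He Hs.
have [Hu|Hu] := leP (4^-1 * c * enorm u) `|dotv u e|.
  exists e; first by lra.
  move=> w; rewrite inE => /predU1P[->//|/Hs].
  by apply: le_trans; have := enorm_ge0 w; nra.
have u0 : 0 < enorm u.
  have : 0 < 4^-1 * c * enorm u by apply: le_lt_trans Hu.
  by rewrite pmulr_rgt0 // mulr_gt0 // invr_gt0 ltr0n.
pose t := c / 2 / enorm u.
have t0 : 0 < t by rewrite !divr_gt0.
have tu : t * enorm u = c / 2 by rewrite /t divfK ?gt_eqF.
exists (e + t *: u).
  apply: le_trans (enormD _ _) _; rewrite enormZ gtr0_norm // tu; lra.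
move=> w; rewrite inE => /predU1P[->|/Hs]; rewrite dotvDr dotvZr.
  rewrite -sqr_enorm expr2 mulrA tu.
  have := ler_norm (dotv u e + c / 2 * enorm u).
  have := ler_norm (- dotv u e); rewrite normrN.
  nra.
move=> Hw; have := lerB_normD (dotv w e) (t * dotv w u).
have := normr_dotv_le w u; rewrite normrM gtr0_norm // -(ler_pM2l t0).
rewrite mulrCA tu; have := enorm_ge0 w; nra.
Qed.

(* [dotv u u * dotv v v - dotv u v ^+ 2] is the squared area [|u /\ v|^2]; as
   [u /\ v = u /\ (v - u)], and contracting [u /\ (v - u)] with [e] gives back
   [v - u], it is comparable to [|v - u|^2]. *)
Lemma gram_comparable u v e : dotv e e <= 1 -> dotv u e = 1 -> dotv v e = 1 ->
  dotv (u - v) (u - v) <= dotv u u * dotv v v - dotv u v ^+ 2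
    <= dotv u u * dotv (u - v) (u - v).
Proof.
move=> e1 ue ve; set w := u - v; set W := dotv w w.
have -> : dotv u u * dotv v v - dotv u v ^+ 2 = dotv u u * W - dotv u w ^+ 2.
  rewrite /W /w !dotvE (dotvC v u); ring.
have we : dotv w e = 0 by rewrite /w dotvBl ue ve subrr.
rewrite gerBl sqr_ge0 andbT; clearbody w.
have [W0|W0] := eqVneq W 0.
  have /eqP : w == 0 by rewrite -dotvv_eq0 -/W W0.
  move=> ->; rewrite W0 -(scale0r u) dotvZr; lra.
have Wp : 0 < W by rewrite lt0r W0 dotvv_ge0.
(* This vector is [W] times the component of [u] orthogonal to [w], and its product with [e] is [W];
   Cauchy-Schwarz then bounds the Gram determinant below by [W]. *)
have := dotv_sqr_le (W *: u - dotv u w *: w) e.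
have -> : dotv (W *: u - dotv u w *: w) e = W.
  by rewrite dotvBl !dotvZl we ue mulr0 subr0 mulr1.
have := dotvv_ge0 (W *: u - dotv u w *: w).
have -> : dotv (W *: u - dotv u w *: w) (W *: u - dotv u w *: w) =
    W * (W * dotv u u - dotv u w ^+ 2).
  rewrite !dotvE -/W (dotvC w u); ring.
rewrite pmulr_rge0 // => H0 /le_trans H.
have : W ^+ 2 <= W * (W * dotv u u - dotv u w ^+ 2).
  by apply: H; rewrite ler_piMr // mulr_ge0 // ltW.
by rewrite expr2 ler_pM2l // [dotv u u * W]mulrC.
Qed.

End Euclidean.

(** The Gram determinant is [1 - cos ^ 2] with the lengths cleared; Cauchy-Schwarz keeps the
    argument of [acos] in [[-1, 1]]. *)
Lemma sqr_sin_angle (R : realType) d (A B C : 'rV[R]_d) : A != B -> C != B ->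
  sin (angle A B C) ^+ 2 * (dotv (A - B) (A - B) * dotv (C - B) (C - B)) =
  dotv (A - B) (A - B) * dotv (C - B) (C - B) - dotv (A - B) (C - B) ^+ 2.
Proof.
rewrite -(subr_eq0 A) -(subr_eq0 C) /angle => A0 C0; move: (A - B) (C - B) A0 C0 => u v u0 v0.
have N0 : 0 < enorm u * enorm v by rewrite mulr_gt0 ?enorm_gt0.
rewrite sin_acos.
  rewrite sqr_sqrtr; last first.
    rewrite subr_ge0 -real_normK ?num_real // expr_le1 // normrM normfV.
    by rewrite (gtr0_norm N0) ler_pdivrMr // mul1r normr_dotv_le.
  rewrite -!sqr_enorm -exprMn mulrBl mul1r -exprMn divfK //; exact: lt0r_neq0.
rewrite -ler_norml normrM normfV (gtr0_norm N0) ler_pdivrMr // mul1r.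
exact: normr_dotv_le.
Qed.

(** * Projection to a plane: from angles to slopes *)

Definition slope_diff (R : realType) (I : Type) (x y : I -> R) (t : I * I * I) : R :=
  (y t.1.1 - y t.1.2) / (x t.1.1 - x t.1.2) - (y t.2 - y t.1.2) / (x t.2 - x t.1.2).

(* A dimension-free projection to the plane: the direction of [p i - p j] is the
   vector of first coordinate 1, so that the angle is measured by the difference
   of two such vectors, and its second coordinate by the difference of slopes. *)
Lemma planar_model (R : realType) m d (p : 'I_m -> 'rV[R]_d) : injective p ->
  exists x y : 'I_m -> R, injective x /\
    forall t : 'I_m * 'I_m * 'I_m, t.1.1 != t.1.2 -> t.2 != t.1.2 ->
    4^-1 ^+ #|{: 'I_m * 'I_m * 'I_m}| * `|sin (angle (p t.1.1) (p t.1.2) (p t.2))|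
      <= `|slope_diff x y t|
      <= (4 ^+ #|{: 'I_m * 'I_m}|) ^+ 2 * `|sin (angle (p t.1.1) (p t.1.2) (p t.2))|.
Proof.
move=> pI.
(* The coordinate along [e] retains a fixed fraction of the length of every [p i - p j]; hence the
   vectors [dir i j] with [i != j] have lengths between 1 and [K]. *)
have [e e1] := exists_separating [seq p u.1 - p u.2 | u : 'I_m * 'I_m].
rewrite size_image => He.
pose x i := dotv (p i) e.
have K0 : 0 < 4 ^+ #|{: 'I_m * 'I_m}| :> R by apply: exprn_gt0.
have Hx i j : enorm (p i - p j) <= 4 ^+ #|{: 'I_m * 'I_m}| * `|x i - x j|.
  rewrite /x -dotvBl -ler_pdivrMl // -exprVn.
  exact/He/(codom_f (fun u : 'I_m * 'I_m => p u.1 - p u.2) (i, j)).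
move: (4 ^+ _) K0 Hx => K K0 Hx.
have xI : injective x.
  move=> i j xij; apply: pI; apply/eqP; rewrite -subr_eq0; apply: contraT.
  by rewrite -enorm_gt0 ltNge (le_trans (Hx i j)) // xij subrr normr0 mulr0.
pose dir i j := (x i - x j)^-1 *: (p i - p j).
have dir_e i j : i != j -> dotv (dir i j) e = 1.
  move=> ij; rewrite dotvZl dotvBl mulVf // subr_eq0.
  by apply: contra ij => /eqP /xI ->.
have dir_ge1 i j : i != j -> 1 <= dotv (dir i j) (dir i j).
  move=> /dir_e E; have := dotv_sqr_le (dir i j) e; rewrite E expr1n.
  have := dotvv_ge0 (dir i j); nra.
have dir_leK i j : i != j -> dotv (dir i j) (dir i j) <= K ^+ 2.
  move=> ij; rewrite -sqr_enorm lerXn2r ?nnegrE ?enorm_ge0 ?(ltW K0) //.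
  rewrite enormZ normfV ler_pdivrMl 1?mulrC ?Hx // normr_gt0 subr_eq0.
  by apply: contra ij => /eqP /xI ->.
(* By [gram_comparable] the length of [w t] is comparable to the sine; a second separating vector
   [f] then reads it off in one coordinate. *)
pose w (t : 'I_m * 'I_m * 'I_m) := dir t.1.1 t.1.2 - dir t.2 t.1.2.
have [f f1] := exists_separating [seq w t | t : 'I_m * 'I_m * 'I_m].
rewrite size_image => Hf.
exists x, (fun i => dotv (p i) f); split=> // t AB CB.
have -> : slope_diff x (fun i => dotv (p i) f) t = dotv (w t) f.
  by rewrite /w /dir !(dotvBl, dotvZl) ![_^-1 * _]mulrC.
move/(_ _ (codom_f w t)) : Hf.
have : 0 <= 4^-1 ^+ #|{: 'I_m * 'I_m * 'I_m}| :> R by rewrite exprn_ge0 ?invr_ge0.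
move: (4^-1 ^+ _) => c c0 Hf.
set S := sin _.
have /andP[] := gram_comparable e1 (dir_e _ _ AB) (dir_e _ _ CB).
(* Rescaling the two vectors by [a] and [b] multiplies both sides of [sqr_sin_angle] by
   [(a * b) ^+ 2]. *)
have -> : dotv (dir t.1.1 t.1.2) (dir t.1.1 t.1.2) *
    dotv (dir t.2 t.1.2) (dir t.2 t.1.2) -
    dotv (dir t.1.1 t.1.2) (dir t.2 t.1.2) ^+ 2 =
    S ^+ 2 * (dotv (dir t.1.1 t.1.2) (dir t.1.1 t.1.2) *
    dotv (dir t.2 t.1.2) (dir t.2 t.1.2)).
  rewrite /dir !(dotvZl, dotvZr).
  have := sqr_sin_angle (A := p t.1.1) (B := p t.1.2) (C := p t.2).
  rewrite !(inj_eq pI) -/S => /(_ AB CB) H.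
  set a := _^-1; set b := _^-1; move: H; set U := dotv _ _; set V := dotv _ _.
  set P := dotv _ _ => H.
  have -> : S ^+ 2 * (a * (a * U) * (b * (b * V))) = (a * b) ^+ 2 * (S ^+ 2 * (U * V)).
    ring.
  rewrite H; ring.
have := dir_ge1 _ _ AB; have := dir_leK _ _ AB.
have := dir_ge1 _ _ CB; have := dir_leK _ _ CB.
rewrite -/(w t); move: Hf; have := dotv_sqr_le (w t) f; rewrite -(sqr_enorm (w t)).
have := enorm_ge0 (w t).
move: (enorm _) (dotv (w t) f) (dotv (dir t.1.1 _) _) (dotv (dir t.2 _) _).
move=> W g U V W0 gW cW VK V1 UK U1 lo up.
have SW : `|S| <= W.
  rewrite -(@ler_pXn2r _ 2) ?nnegrE // real_normK ?num_real //.
  have : S ^+ 2 * V <= W ^+ 2.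
    by rewrite -(ler_pM2l (lt_le_trans ltr01 U1)) mulrCA.
  by have := sqr_ge0 S; nra.
have gle : `|g| <= W.
  rewrite -(@ler_pXn2r _ 2) ?nnegrE // real_normK ?num_real //.
  by apply: le_trans gW _; rewrite ler_piMr ?sqr_ge0.
apply/andP; split; first by apply: le_trans cW; rewrite ler_wpM2l.
apply: le_trans gle _.
rewrite -(@ler_pXn2r _ 2) ?nnegrE ?mulr_ge0 ?sqr_ge0 ?(ltW K0) // exprMn real_normK ?num_real //.
apply: le_trans lo _; rewrite mulrC ler_wpM2r ?sqr_ge0 // expr2.
by apply: ler_pM => //; apply: le_trans ler01 _.
Qed.

(** * Normalised plane configurations *)

Section NormalizedCoordinates.
Variables (R : realType) (k : nat).

(* Up to maps (x, y) |-> (a x + b, a y + c x + e), which preserve differences of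
   slopes, point 0 is (0, 0) and point 1 is (1, 0); [b = true] selects the
   abscissa. *)
Definition coord (b : bool) (i : 'I_k.+2) (z : bool * 'I_k -> R) : R :=
  if unlift ord0 i is Some j then
    if unlift ord0 j is Some l then z (b, l) else b%:R
  else 0.

Lemma poly_fun_coord b i : poly_fun 1 (coord b i).
Proof.
rewrite /coord; case: (unlift _ i) => [j|]; last exact: poly_fun_const.
case: (unlift _ j) => [l|]; [exact: poly_fun_var | exact: poly_fun_const].
Qed.

Lemma coord_normalized (b : bool) (g : 'I_k.+2 -> R) (z : bool * 'I_k -> R) :
  g ord0 = 0 -> g (lift ord0 ord0) = b%:R ->
  (forall l, z (b, l) = g (lift ord0 (lift ord0 l))) ->
  forall i, coord b i z = g i.
Proof.
move=> g0 g1 gz i; rewrite /coord.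
by case: unliftP => [j|] ->; rewrite ?g0 //; case: unliftP => [l|] ->.
Qed.

Lemma normalize_model (x y : 'I_k.+2 -> R) : injective x -> exists z,
  [/\ injective (fun i => coord true i z) &
    forall t, t.1.1 != t.1.2 -> t.2 != t.1.2 ->
      slope_diff (fun i => coord true i z) (fun i => coord false i z) t =
      slope_diff x y t].
Proof.
move=> xI; set o := ord0 : 'I_k.+2; set l := lift ord0 ord0 : 'I_k.+2.
have nz i j : i != j -> x i - x j != 0.
  by move=> ij; rewrite subr_eq0; apply: contra ij => /eqP /xI ->.
have h0 : x l - x o != 0 by exact: nz.
(* Scaling both coordinates alike keeps slopes; the shear by [s], the slope of the line through
   points 0 and 1, lowers every slope by [s], which cancels in differences. *)
pose X i := (x i - x o) / (x l - x o).
pose s := (y l - y o) / (x l - x o).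
pose Y i := (y i - y o) / (x l - x o) - s * X i.
pose z (u : bool * 'I_k) := (if u.1 then X else Y) (lift ord0 (lift ord0 u.2)).
have EX i : coord true i z = X i.
  by apply: coord_normalized; rewrite // /X ?subrr ?mul0r ?divff.
have EY i : coord false i z = Y i.
  apply: coord_normalized; rewrite // /Y /X ?subrr ?mul0r ?mulr0 ?subr0 //.
  by rewrite divff // mulr1 subrr.
exists z; split=> [i j|[[A B] C] /= AB CB].
  by rewrite /= !EX => /(mulIf (invr_neq0 h0)) /addIr /xI.
rewrite /slope_diff /= !EX !EY /Y /X; have := nz _ _ AB; have := nz _ _ CB.
move: h0; rewrite /s => h0 h1 h2.
have E i j : (x i - x o) / (x l - x o) - (x j - x o) / (x l - x o) =
   (x i - x j) / (x l - x o) by field.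
rewrite !E; field.
by rewrite h0 h1 h2.
Qed.

End NormalizedCoordinates.

(** * Choice of the angles *)

Lemma exists_lt_all (R : realFieldType) (I : finType) (r : I -> R) :
  (forall i, 0 < r i) -> exists2 delta, 0 < delta < 1 & forall i, delta < r i.
Proof.
move=> r0; have S0 : 0 <= \sum_i (r i)^-1 by apply: sumr_ge0 => i _; rewrite ltW ?invr_gt0.
(* The summand 2 makes all inequalities strict and keeps the value below 1. *)
exists (2 + \sum_i (r i)^-1)^-1.
  by rewrite invr_gt0 invf_lt1; lra.
move=> i; rewrite -[r i]invrK ltf_pV2 ?posrE ?invr_gt0 //; last by lra.
rewrite (bigD1 i) //=.
have : 0 <= \sum_(j | j != i) (r j)^-1 by apply: sumr_ge0 => j _; rewrite ltW ?invr_gt0.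
lra.
Qed.

Lemma asin_gt0_ltpi (R : realType) (s : R) : 0 < s <= 1 -> 0 < asin s < pi.
Proof.
move=> /andP[s0 s1].
have /asin_def[/andP[lo hi] Es] : -1 <= s <= 1 by lra.
have pi0 := pi_gt0 R.
apply/andP; split; last by lra.
rewrite ltNge; apply/negP => le0.
have : 0 <= sin (- asin s) by apply: sin_ge0_pi; lra.
by rewrite sinN Es oppr_ge0 leNgt s0.
Qed.

(** Normalisation leaves [2 * k] parameters for [(2 * k).+1] sines, so each choice of triples [t]
    forces a relation among slope differences. The resulting threshold on [delta] depends neither on
    [d] nor on the points, and there are finitely many [t]. *)
Lemma exists_unrealisable_sines (R : realType) (k : nat) :
  exists D (delta : R), [/\ (0 < D)%N, 0 < delta < 1 &
    forall d (p : 'I_k.+2 -> 'rV[R]_d), injective p ->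
    ~ exists t : 'I_(2 * k).+1 -> 'I_k.+2 * 'I_k.+2 * 'I_k.+2, forall i,
      [/\ (t i).1.1 != (t i).1.2, (t i).2 != (t i).1.2 &
       sin (angle (p (t i).1.1) (p (t i).1.2) (p (t i).2)) = delta ^+ (D.+1 ^ i)]].
Proof.
set n := (2 * k).+1; pose T := ('I_k.+2 * 'I_k.+2 * 'I_k.+2)%type.
pose num (t : T) (z : bool * 'I_k -> R) :=
  (coord false t.1.1 z - coord false t.1.2 z) * (coord true t.2 z - coord true t.1.2 z)
  - (coord false t.2 z - coord false t.1.2 z) * (coord true t.1.1 z - coord true t.1.2 z).
pose den (t : T) (z : bool * 'I_k -> R) :=
  (coord true t.1.1 z - coord true t.1.2 z) * (coord true t.2 z - coord true t.1.2 z).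
have num2 t : poly_fun 2 (num t).
  apply: poly_funB; apply: (@poly_funM _ _ 1 1); apply: poly_funB; exact: poly_fun_coord.
have den2 t : poly_fun 2 (den t).
  apply: (@poly_funM _ _ 1 1); apply: poly_funB; exact: poly_fun_coord.
pose D := ((2 * n) ^ #|{: bool * 'I_k}|)%N.
have D0 : (0 < D)%N by rewrite expn_gt0.
have ltn : (#|{: bool * 'I_k}| < n)%N by rewrite card_prod card_bool card_ord.
have rel (t : {ffun 'I_n -> T}) := @exists_algebraic_relation R _ n 2 D
  (fun i => num (t i)) (fun i => den (t i)) isT ltn (leqnn D)
  (fun i => num2 (t i)) (fun i => den2 (t i)).
have c0 : 0 < 4^-1 ^+ #|{: T}| :> R by rewrite exprn_gt0 // invr_gt0.
have C0 : 0 <= (4 ^+ #|{: 'I_k.+2 * 'I_k.+2}|) ^+ 2 :> R by exact: sqr_ge0.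
have /fin_all_exists[r Hr] (t : {ffun 'I_n -> T}) : exists r : R, 0 < r /\
    forall delta, 0 < delta <= 1 -> delta < r -> forall z,
    (forall i, den (t i) z != 0) ->
    ~ (forall i : 'I_n, 4^-1 ^+ #|{: T}| * delta ^+ (D.+1 ^ i)
         <= `|num (t i) z / den (t i) z|
         <= (4 ^+ #|{: 'I_k.+2 * 'I_k.+2}|) ^+ 2 * delta ^+ (D.+1 ^ i)).
  have [v v0 Hv] := rel t.
  have [r r0 Hr] := lacunary_no_relation v0 c0 C0.
  exists r; split=> // delta d01 dr z denz /(Hr _ d01 dr) /negP; apply.
  (* Multiplying by the common denominator turns the sum over the quotients into the relation
     [Hv]. *)
  have q0 : \prod_i den (t i) z ^+ D != 0.
    by apply/prodf_neq0 => i _; rewrite expf_neq0.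
  rewrite -(mulIr_eq0 _ (mulIf q0)); apply/eqP; rewrite -[RHS](Hv z) mulr_suml.
  apply: eq_bigr => a _; rewrite -mulrA -big_split /=; congr (_ * _).
  apply: eq_bigr => i _; rewrite expr_div_n.
  have -> : den (t i) z ^+ D = den (t i) z ^+ a i * den (t i) z ^+ (D - a i).
    by rewrite -exprD subnKC // -ltnS.
  by rewrite mulrA divfK // expf_neq0.
have [delta /andP[d0 d1] Hd] := exists_lt_all (fun t => proj1 (Hr t)).
exists D, delta; split=> //; first by rewrite d0.
move=> d p pI [t Ht].
have [x [y [xI Hxy]]] := planar_model pI.
have [z [zI Hz]] := normalize_model y xI.
have cz i j : i != j -> coord true i z - coord true j z != 0.
  by move=> ij; rewrite subr_eq0; apply: contra ij => /eqP /zI ->.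
have dz i : den (finfun t i) z != 0.
  by rewrite ffunE; have [H1 H2 _] := Ht i; rewrite mulf_neq0 ?cz.
case: (Hr (finfun t)) => _ /(_ delta _ (Hd _) z dz); apply; first by rewrite d0 ltW.
move=> i; have [H1 H2 Hs] := Ht i.
have := Hxy _ H1 H2; rewrite Hs -Hz // gtr0_norm ?exprn_gt0 //.
rewrite ffunE /slope_diff /num /den => H.
have quot a b c' d' : c' != 0 -> d' != 0 ->
    (a * d' - b * c') / (c' * d') = a / c' - b / d' :> R.
  by move=> c'0 d'0; field; rewrite c'0 d'0.
by rewrite quot ?cz.
Qed.

Theorem theorem2 (R : realType) (m : nat) (hm : (2 <= m)%N) :
  exists S : set R,
    [/\ (S #= `I_(2 * m - 3))%card,
        S `<=` [set theta : R | 0 < theta < pi] &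
        forall (d : nat) (X : set 'rV[R]_d), (X #= `I_m)%card ->
          ~ (forall theta : R, S theta -> realises X theta)].
Proof.
case: m hm => [|[|k]] // _.
have -> : (2 * k.+2 - 3 = (2 * k).+1)%N by lia.
have [D [delta [D0 /andP[d0 d1] H]]] := exists_unrealisable_sines R k.
pose s i := delta ^+ (D.+1 ^ i).
have s01 i : 0 < s i <= 1 by rewrite exprn_gt0 //= exprn_ile1 // ltW.
have sinE i : sin (asin (s i)) = s i.
  by have /andP[s0 s1] := s01 i; apply: (asin_def _).2; lra.
exists [set asin (s i) | i in `I_(2 * k).+1]; split.
(* Taking sines recovers [s i]; these differ since [0 < delta < 1] and, by [0 < D], the exponents
   [D.+1 ^ i] are distinct. *)
- apply: inj_card_eq => i j _ _ /(congr1 sin); rewrite !sinE.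
  by move=> /(ieexprIn d0 (negbT (lt_eqF d1))) /(@expnI D.+1 D0 i j).
- by move=> _ [i _ <-]; exact: asin_gt0_ltpi.
move=> d X /card_set_bijP[f [fX fI fS]] real.
have /fin_all_exists[p Hp] (i : 'I_k.+2) : exists P, X P /\ f P = i.
  by have [P XP fP] := fS _ (ltn_ord i); exists P.
have label P : X P -> exists i, p i = P.
  move=> XP; exists (Ordinal (fX _ XP)); have [XQ fQ] := Hp (Ordinal (fX _ XP)).
  by apply: fI; rewrite ?inE.
have p_inj : injective p.
  by move=> i j E; apply: val_inj; rewrite /= -(Hp i).2 -(Hp j).2 E.
suff /fin_all_exists[t Ht] (i : 'I_(2 * k).+1) : exists t : 'I_k.+2 * 'I_k.+2 * 'I_k.+2,
    [/\ t.1.1 != t.1.2, t.2 != t.1.2 &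
     sin (angle (p t.1.1) (p t.1.2) (p t.2)) = delta ^+ (D.+1 ^ i)].
  by apply: (H d p p_inj); exists t.
have [|A [B [C [[XA XB XC] [AB CB E]]]]] := real (asin (s i)); first by exists (val i) => /=.
have [[a Ea] [b Eb] [c Ec]] := And3 (label _ XA) (label _ XB) (label _ XC).
exists (a, b, c) => /=; rewrite Ea Eb Ec E sinE; split=> //.
  by apply: contra AB => /eqP ab; rewrite -Ea -Eb ab.
by apply: contra CB => /eqP cb; rewrite -Ec -Eb cb.
Qed.
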